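(* Let $\mathsf{SR}^{\mathrm{c}}$ be the subvariety of the variety of srl-monoids generated by its totally ordered members. Then the identities $\mathrm{C}_2$: $e\wedge (x\vee y) = (e\wedge x) \vee (e\wedge y)$ and $\mathrm{E}_2$: $z\rightarrow (x\vee y) = (z\rightarrow x) \vee (z\rightarrow y)$, together with identities defining the variety of srl-monoids, form an equational basis for $\mathsf{SR}^{\mathrm{c}}$.
   Context: A commutative l-monoid is an algebra $(A,\wedge,\vee,\cdot,e)$ of type $(2,2,2,0)$ such that $(A,\wedge,\vee)$ is a lattice, $(A,\cdot,e)$ is a commutative monoid and $(a\vee b)\cdot c=(a\cdot c)\vee(b\cdot c)$ for all $a,b,c\in A$. An algebra $(A,\wedge,\vee,\cdot,\rightarrow,e)$ of type $(2,2,2,2,0)$ is an srl-monoid if $(A,\wedge,\vee,\cdot,e)$ is a commutative l-monoid and there is a subalgebra $Q$ of $(A,\wedge,\vee,\cdot,e)$ such that for all $a,b\in A$ the set $\{q\in Q: a\cdot q\leq b\}$ has a maximum and $a\rightarrow b$ equals this maximum. The class of srl-monoids is a variety; it is axiomatized by the commutative l-monoid identities together with: $e\leq (x\wedge y)\rightarrow y$; $x\rightarrow y \leq (z\wedge e)\rightarrow (x\rightarrow y)$; $x\cdot (x\rightarrow y) \leq y$; $z\rightarrow (x\wedge y) = (z\rightarrow x)\wedge (z\rightarrow y)$; $e\rightarrow ((e\rightarrow x)\cdot(e\rightarrow y)) = (e\rightarrow x)\cdot (e\rightarrow y)$; $e\rightarrow y \leq x \rightarrow (x\cdot (e\rightarrow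 y))$. A totally ordered srl-monoid is one whose lattice order is a chain. *)

(* Defs.v *)
From Stdlib Require Import List.
Import ListNotations.

Record algebra : Type := Algebra {
  carrier :> Type;
  meet : carrier -> carrier -> carrier;
  join : carrier -> carrier -> carrier;
  mul : carrier -> carrier -> carrier;
  imp : carrier -> carrier -> carrier;
  neutral : carrier
}.

Arguments meet {a} _ _.
Arguments join {a} _ _.
Arguments mul {a} _ _.
Arguments imp {a} _ _.
Arguments neutral {a}.

Declare Scope alg_scope.
Delimit Scope alg_scope with alg.
Notation "x ⊓ y" := (meet x y) (at level 50, left associativity) : alg_scope.
Notation "x ⊔ y" := (join x y) (at level 50, left associativity) : alg_scope.
Notation "x ⋅ y" := (mul x y) (at level 40, left associativity) : alg_scope.
Notation "x ⇒ y" := (imp x y) (at level 55, right associativity) : alg_scope.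

Definition le {A : algebra} (x y : A) : Prop := meet x y = x.
Notation "x ⊑ y" := (le x y) (at level 70, no associativity) : alg_scope.

Local Open Scope alg_scope.

Record is_lattice (A : algebra) : Prop := IsLattice {
  meet_comm : forall a b : A, a ⊓ b = b ⊓ a;
  meet_assoc : forall a b c : A, a ⊓ (b ⊓ c) = (a ⊓ b) ⊓ c;
  join_comm : forall a b : A, a ⊔ b = b ⊔ a;
  join_assoc : forall a b c : A, a ⊔ (b ⊔ c) = (a ⊔ b) ⊔ c;
  meet_join_absorb : forall a b : A, a ⊓ (a ⊔ b) = a;
  join_meet_absorb : forall a b : A, a ⊔ (a ⊓ b) = a
}.

(* The operation [imp] plays no role here: this is a property of the reduct
   (A, meet, join, mul, neutral). *)
Record is_comm_l_monoid (A : algebra) : Prop := IsCommLMonoid {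
  clm_lattice : is_lattice A;
  mul_comm : forall a b : A, a ⋅ b = b ⋅ a;
  mul_assoc : forall a b c : A, a ⋅ (b ⋅ c) = (a ⋅ b) ⋅ c;
  mul_unit : forall a : A, a ⋅ neutral = a;
  mul_join_distr : forall a b c : A, (a ⊔ b) ⋅ c = (a ⋅ c) ⊔ (b ⋅ c)
}.

(* Subuniverses of the reduct (A, meet, join, mul, neutral), without [imp]. *)
Record l_monoid_subalgebra (A : algebra) (Q : A -> Prop) : Prop :=
  LMonoidSubalgebra {
  sub_meet : forall a b : A, Q a -> Q b -> Q (a ⊓ b);
  sub_join : forall a b : A, Q a -> Q b -> Q (a ⊔ b);
  sub_mul : forall a b : A, Q a -> Q b -> Q (a ⋅ b);
  sub_unit : Q neutral
}.

Definition is_max {A : algebra} (S : A -> Prop) (m : A) : Prop :=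
  S m /\ forall q : A, S q -> q ⊑ m.

Definition srl_monoid (A : algebra) : Prop :=
  is_comm_l_monoid A /\
  exists Q : A -> Prop, l_monoid_subalgebra A Q /\
    forall a b : A, is_max (fun q : A => Q q /\ a ⋅ q ⊑ b) (a ⇒ b).

Definition totally_ordered (A : algebra) : Prop :=
  forall a b : A, a ⊑ b \/ b ⊑ a.

Record is_hom (A B : algebra) (f : A -> B) : Prop := IsHom {
  hom_meet : forall a b : A, f (a ⊓ b) = f a ⊓ f b;
  hom_join : forall a b : A, f (a ⊔ b) = f a ⊔ f b;
  hom_mul : forall a b : A, f (a ⋅ b) = f a ⋅ f b;
  hom_imp : forall a b : A, f (a ⇒ b) = f a ⇒ f b;
  hom_unit : f neutral = neutral
}.

Definition prod_algebra (I : Type) (A : I -> algebra) : algebra :=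
  Algebra (forall i : I, A i)
    (fun x y i => x i ⊓ y i) (fun x y i => x i ⊔ y i)
    (fun x y i => x i ⋅ y i) (fun x y i => x i ⇒ y i)
    (fun i => neutral).

(* Subalgebras are taken up to isomorphism, as domains of injective
   homomorphisms. *)
Record is_variety (V : algebra -> Prop) : Prop := IsVariety {
  variety_H : forall (A B : algebra) (f : A -> B),
    is_hom A B f -> (forall b : B, exists a : A, f a = b) -> V A -> V B;
  variety_S : forall (A B : algebra) (f : A -> B),
    is_hom A B f -> (forall a a' : A, f a = f a' -> a = a') -> V B -> V A;
  variety_P : forall (I : Type) (A : I -> algebra),
    (forall i : I, V (A i)) -> V (prod_algebra I A)
}.

Definition generated_variety (K : algebra -> Prop) (A : algebra) : Prop :=
  forall V : algebra -> Prop,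
    is_variety V -> (forall B : algebra, K B -> V B) -> V A.

Definition SRc : algebra -> Prop :=
  generated_variety (fun A => srl_monoid A /\ totally_ordered A).

Inductive term : Type :=
| Var (n : nat)
| Meet (s t : term)
| Join (s t : term)
| Mul (s t : term)
| Imp (s t : term)
| Unit.

Fixpoint eval {A : algebra} (v : nat -> A) (t : term) : A :=
  match t with
  | Var n => v n
  | Meet s t => eval v s ⊓ eval v t
  | Join s t => eval v s ⊔ eval v t
  | Mul s t => eval v s ⋅ eval v t
  | Imp s t => eval v s ⇒ eval v t
  | Unit => neutral
  end.

Record identity : Type := Identity { lhs : term; rhs : term }.

Definition satisfies (A : algebra) (i : identity) : Prop :=
  forall v : nat -> A, eval v (lhs i) = eval v (rhs i).

Definition equational_basis (Sigma : identity -> Prop) (V : algebra -> Prop) :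
  Prop :=
  forall A : algebra, V A <-> (forall i : identity, Sigma i -> satisfies A i).

Notation "s ≈ t" := (Identity s t) (at level 70, no associativity).
Notation "s ≼ t" := (Identity (Meet s t) s) (at level 70, no associativity).

Definition C2 : identity :=
  let x := Var 0 in let y := Var 1 in
  Meet Unit (Join x y) ≈ Join (Meet Unit x) (Meet Unit y).

Definition E2 : identity :=
  let x := Var 0 in let y := Var 1 in let z := Var 2 in
  Imp z (Join x y) ≈ Join (Imp z x) (Imp z y).

Definition comm_l_monoid_identities : list identity :=
  let x := Var 0 in let y := Var 1 in let z := Var 2 in
  [ Meet x y ≈ Meet y x;
    Meet x (Meet y z) ≈ Meet (Meet x y) z;
    Join x y ≈ Join y x;
    Join x (Join y z) ≈ Join (Join x y) z;
    Meet x (Join x y) ≈ x;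
    Join x (Meet x y) ≈ x;
    Mul x y ≈ Mul y x;
    Mul x (Mul y z) ≈ Mul (Mul x y) z;
    Mul x Unit ≈ x;
    Mul (Join x y) z ≈ Join (Mul x z) (Mul y z) ].

Definition srl_identities : list identity :=
  let x := Var 0 in let y := Var 1 in let z := Var 2 in
  comm_l_monoid_identities ++
  [ Unit ≼ Imp (Meet x y) y;
    Imp x y ≼ Imp (Meet z Unit) (Imp x y);
    Mul x (Imp x y) ≼ y;
    Imp z (Meet x y) ≈ Meet (Imp z x) (Imp z y);
    Imp Unit (Mul (Imp Unit x) (Imp Unit y))
      ≈ Mul (Imp Unit x) (Imp Unit y);
    Imp Unit y ≼ Imp x (Mul x (Imp Unit y)) ].

Section CommLMonoidFacts.

Variable A : algebra.
Hypothesis HA : is_comm_l_monoid A.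
Let L := clm_lattice A HA.

Lemma meet_idem (a : A) : a ⊓ a = a.
Proof.
  rewrite <- (join_meet_absorb A L a a) at 2. apply (meet_join_absorb A L).
Qed.

Lemma le_refl (a : A) : a ⊑ a.
Proof. apply meet_idem. Qed.

Lemma le_antisym (a b : A) : a ⊑ b -> b ⊑ a -> a = b.
Proof.
  unfold le; intros H K. rewrite <- H, (meet_comm A L). exact K.
Qed.

Lemma le_trans (a b c : A) : a ⊑ b -> b ⊑ c -> a ⊑ c.
Proof.
  unfold le; intros H K. rewrite <- H, <- (meet_assoc A L), K. reflexivity.
Qed.

Lemma le_meet_l (a b : A) : a ⊓ b ⊑ a.
Proof.
  unfold le. rewrite (meet_comm A L), (meet_assoc A L), meet_idem. reflexivity.
Qed.

Lemma le_meet_r (a b : A) : a ⊓ b ⊑ b.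
Proof. unfold le. rewrite <- (meet_assoc A L), meet_idem. reflexivity. Qed.

Lemma le_meet (a b c : A) : a ⊑ b -> a ⊑ c -> a ⊑ b ⊓ c.
Proof. unfold le; intros H K. rewrite (meet_assoc A L), H. exact K. Qed.

Lemma le_join_l (a b : A) : a ⊑ a ⊔ b.
Proof. apply (meet_join_absorb A L). Qed.

Lemma le_join_r (a b : A) : b ⊑ a ⊔ b.
Proof. rewrite (join_comm A L). apply le_join_l. Qed.

Lemma le_joinP (a b : A) : a ⊑ b <-> a ⊔ b = b.
Proof.
  split; intros H.
  - unfold le in H. rewrite <- H, (join_comm A L), (meet_comm A L).
    apply (join_meet_absorb A L).
  - rewrite <- H. apply le_join_l.
Qed.

Lemma join_le (a b c : A) : a ⊑ c -> b ⊑ c -> a ⊔ b ⊑ c.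
Proof.
  rewrite !le_joinP; intros H K.
  rewrite <- (join_assoc A L), K. exact H.
Qed.

Lemma mul_mono (a b c : A) : a ⊑ b -> c ⋅ a ⊑ c ⋅ b.
Proof.
  rewrite !le_joinP; intros H.
  rewrite !(mul_comm A HA c), <- (mul_join_distr A HA), H. reflexivity.
Qed.

Lemma unit_mul (a : A) : neutral ⋅ a = a.
Proof. rewrite (mul_comm A HA). apply (mul_unit A HA). Qed.

End CommLMonoidFacts.

Lemma comm_l_monoid_identities_basis :
  equational_basis (fun i => In i comm_l_monoid_identities) is_comm_l_monoid.
Proof.
  intros A; split.
  - intros [[] ? ? ? ?] i Hi v. simpl in Hi.
    repeat (destruct Hi as [<- | Hi]; [simpl; auto |]). destruct Hi.
  - intros H.
    pose (v := fun (a b c : A) (n : nat) =>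
                 match n with 0 => a | 1 => b | _ => c end).
    constructor; [constructor | ..]; intros a;
      try (intros b; try (intros c)).
    + exact (H (Meet (Var 0) (Var 1) ≈ Meet (Var 1) (Var 0))
               ltac:(simpl; tauto) (v a b b)).
    + exact (H (Meet (Var 0) (Meet (Var 1) (Var 2))
                  ≈ Meet (Meet (Var 0) (Var 1)) (Var 2))
               ltac:(simpl; tauto) (v a b c)).
    + exact (H (Join (Var 0) (Var 1) ≈ Join (Var 1) (Var 0))
               ltac:(simpl; tauto) (v a b b)).
    + exact (H (Join (Var 0) (Join (Var 1) (Var 2))
                  ≈ Join (Join (Var 0) (Var 1)) (Var 2))
               ltac:(simpl; tauto) (v a b c)).
    + exact (H (Meet (Var 0) (Join (Var 0) (Var 1)) ≈ Var 0)
               ltac:(simpl; tauto) (v a b b)).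
    + exact (H (Join (Var 0) (Meet (Var 0) (Var 1)) ≈ Var 0)
               ltac:(simpl; tauto) (v a b b)).
    + exact (H (Mul (Var 0) (Var 1) ≈ Mul (Var 1) (Var 0))
               ltac:(simpl; tauto) (v a b b)).
    + exact (H (Mul (Var 0) (Mul (Var 1) (Var 2))
                  ≈ Mul (Mul (Var 0) (Var 1)) (Var 2))
               ltac:(simpl; tauto) (v a b c)).
    + exact (H (Mul (Var 0) Unit ≈ Var 0) ltac:(simpl; tauto) (v a a a)).
    + exact (H (Mul (Join (Var 0) (Var 1)) (Var 2)
                  ≈ Join (Mul (Var 0) (Var 2)) (Mul (Var 1) (Var 2)))
               ltac:(simpl; tauto) (v a b c)).
Qed.

(* The class of srl-monoids, defined through the existence of [Q], is a variety;
   in particular it has an equational basis. *)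
Theorem srl_identities_basis :
  equational_basis (fun i => In i srl_identities) srl_monoid.
Proof.
  intros A; split.
  - intros [HA [Q [[Qm Qj Qp Qe] Himp]]] i Hi.
    unfold srl_identities in Hi. apply in_app_or in Hi. destruct Hi as [Hi | Hi].
    { exact (proj1 (comm_l_monoid_identities_basis A) HA i Hi). }
    assert (HQ : forall a b : A, Q (a ⇒ b)) by (intros a b; apply (Himp a b)).
    assert (Hev : forall a b : A, a ⋅ (a ⇒ b) ⊑ b)
      by (intros a b; apply (Himp a b)).
    assert (Hmax : forall a b q : A, Q q -> a ⋅ q ⊑ b -> q ⊑ (a ⇒ b))
      by (intros a b q H K; apply (Himp a b); auto).
    assert (Hev1 : forall b : A, (neutral ⇒ b) ⊑ b)
      by (intros b; generalize (Hev neutral b); rewrite unit_mul; auto).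
    intros v. simpl in Hi.
    repeat (destruct Hi as [<- | Hi]; [simpl; set (x := v 0); set (y := v 1);
      try set (z := v 2) |]); [.. | destruct Hi].
    + apply Hmax; auto. rewrite (mul_unit A HA). apply (le_meet_r A HA).
    + apply Hmax; auto. rewrite (mul_comm A HA).
      apply (le_trans A HA) with ((x ⇒ y) ⋅ neutral).
      * apply (mul_mono A HA), (le_meet_r A HA).
      * rewrite (mul_unit A HA). apply (le_refl A HA).
    + apply Hev.
    + apply (le_antisym A HA).
      * apply (le_meet A HA); apply Hmax; auto;
          eapply (le_trans A HA); [apply Hev | | apply Hev |].
        -- apply (le_meet_l A HA).
        -- apply (le_meet_r A HA).
      * apply Hmax; auto. apply (le_meet A HA).
        -- apply (le_trans A HA) with (z ⋅ (z ⇒ x)); auto.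
           apply (mul_mono A HA), (le_meet_l A HA).
        -- apply (le_trans A HA) with (z ⋅ (z ⇒ y)); auto.
           apply (mul_mono A HA), (le_meet_r A HA).
    + apply (le_antisym A HA); auto. apply Hmax; auto.
      rewrite (unit_mul A HA). apply (le_refl A HA).
    + apply Hmax; auto. apply (le_refl A HA).
  - intros H.
    assert (HA : is_comm_l_monoid A).
    { apply comm_l_monoid_identities_basis. intros i Hi. apply H.
      unfold srl_identities. apply in_or_app; auto. }
    assert (H' := fun i Hi => H i (in_or_app comm_l_monoid_identities _ i
                                     (or_intror Hi))).
    clear H; rename H' into H.
    pose (v := fun (a b c : A) (n : nat) =>
                 match n with 0 => a | 1 => b | _ => c end).
    assert (I1 : forall x y : A, neutral ⊑ (x ⊓ y ⇒ y)).
    { intros x y. exact (H (Unit ≼ Imp (Meet (Var 0) (Var 1)) (Var 1))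
                           ltac:(simpl; tauto) (v x y y)). }
    assert (I2 : forall x y z : A, (x ⇒ y) ⊑ (z ⊓ neutral ⇒ (x ⇒ y))).
    { intros x y z.
      exact (H (Imp (Var 0) (Var 1)
                  ≼ Imp (Meet (Var 2) Unit) (Imp (Var 0) (Var 1)))
               ltac:(simpl; tauto) (v x y z)). }
    assert (I3 : forall x y : A, x ⋅ (x ⇒ y) ⊑ y).
    { intros x y. exact (H (Mul (Var 0) (Imp (Var 0) (Var 1)) ≼ Var 1)
                           ltac:(simpl; tauto) (v x y y)). }
    assert (I4 : forall x y z : A, (z ⇒ x ⊓ y) = (z ⇒ x) ⊓ (z ⇒ y)).
    { intros x y z.
      exact (H (Imp (Var 2) (Meet (Var 0) (Var 1))
                  ≈ Meet (Imp (Var 2) (Var 0)) (Imp (Var 2) (Var 1)))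
               ltac:(simpl; tauto) (v x y z)). }
    assert (I5 : forall x y : A,
              (neutral ⇒ (neutral ⇒ x) ⋅ (neutral ⇒ y)) = (neutral ⇒ x) ⋅ (neutral ⇒ y)).
    { intros x y.
      exact (H (Imp Unit (Mul (Imp Unit (Var 0)) (Imp Unit (Var 1)))
                  ≈ Mul (Imp Unit (Var 0)) (Imp Unit (Var 1)))
               ltac:(simpl; tauto) (v x y y)). }
    assert (I6 : forall x y : A, (neutral ⇒ y) ⊑ (x ⇒ x ⋅ (neutral ⇒ y))).
    { intros x y.
      exact (H (Imp Unit (Var 1) ≼ Imp (Var 0) (Mul (Var 0) (Imp Unit (Var 1))))
               ltac:(simpl; tauto) (v x y y)). }
    clear H v.
    assert (Hmono : forall a b c : A, a ⊑ b -> (c ⇒ a) ⊑ (c ⇒ b)).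
    { intros a b c K. unfold le. rewrite <- I4, K. reflexivity. }
    assert (Hev1 : forall b : A, (neutral ⇒ b) ⊑ b)
      by (intros b; generalize (I3 neutral b); rewrite unit_mul; auto).
    assert (Hbox : forall a b : A, (neutral ⇒ (a ⇒ b)) = (a ⇒ b)).
    { intros a b. apply (le_antisym A HA); auto.
      generalize (I2 a b neutral). rewrite (meet_idem A HA). auto. }
    split; [exact HA |]. exists (fun q => (neutral ⇒ q) = q). split.
    + split.
      * intros a b Ha Hb. rewrite I4, Ha, Hb. reflexivity.
      * intros a b Ha Hb. apply (le_antisym A HA); auto.
        apply (join_le A HA); [rewrite <- Ha at 1 | rewrite <- Hb at 1];
          apply Hmono; [apply (le_join_l A HA) | apply (le_join_r A HA)].
      * intros a b Ha Hb. rewrite <- Ha, <- Hb. apply I5.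
      * apply (le_antisym A HA); auto.
        generalize (I1 neutral neutral). rewrite (meet_idem A HA). auto.
    + intros a b. split.
      * split; auto.
      * intros q [Hq K]. rewrite <- Hq.
        apply (le_trans A HA) with (a ⇒ a ⋅ (neutral ⇒ q)); auto.
        apply Hmono. rewrite Hq. exact K.
Qed.

(* Main.v *)
Require Import Defs.
From Stdlib Require Import Classical ClassicalEpsilon.
From Stdlib Require Import FunctionalExtensionality PropExtensionality.
From mathcomp Require classical_sets.

(** If [A] satisfies C2 and E2, then [e = (e ∧ (x → y)) ∨ (e ∧ (y → x))] for
    all [x, y].  Let [Q] be the subalgebra that defines the implication.  Each
    submonoid [F] of the negative cone of [Q] gives a congruence, whose quotient
    order is [x ≤ y] iff [f x ≤ y] for some [f] in [F].  If [a ≰ b], Zorn's lemma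
    yields a submonoid [F] maximal for containing no [f] with [f a ≤ b].  Since
    [p ∨ q = e] implies [p^n ∨ q^m = e] for negative [p, q], this [F] contains
    [p] or [q] whenever [p ∨ q = e], so the quotient is a chain, and there the
    class of [a] is not below that of [b].  Hence [A] embeds in a product of
    chains. *)

Local Open Scope alg_scope.

(** * Preservation of identities under homomorphic images, subalgebras and products *)

Lemma eval_hom (A B : algebra) (f : A -> B) (Hf : is_hom A B f) (v : nat -> A)
  (t : term) : f (eval v t) = eval (fun n => f (v n)) t.
Proof.
  destruct Hf as [Hm Hj Hp Hi He].
  induction t; simpl; congruence.
Qed.

Lemma eval_prod (I : Type) (A : I -> algebra) (v : nat -> prod_algebra I A)
  (t : term) (i : I) :
  (eval v t : forall i, A i) i = eval (fun n => v n i) t.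
Proof. induction t; simpl; congruence. Qed.

Lemma satisfies_hom_image (A B : algebra) (f : A -> B) (i : identity) :
  is_hom A B f -> (forall b : B, exists a : A, f a = b) ->
  satisfies A i -> satisfies B i.
Proof.
  intros Hf Hsurj HA v.
  (* By choice, [w] lifts the valuation [v] along the surjection. *)
  pose (w := fun n => proj1_sig
               (constructive_indefinite_description _ (Hsurj (v n)))).
  assert (Hw : v = fun n => f (w n)).
  { apply functional_extensionality; intros n. unfold w.
    destruct constructive_indefinite_description; auto. }
  rewrite Hw, <- !(eval_hom A B f Hf). f_equal. apply HA.
Qed.

Lemma satisfies_variety (i : identity) :
  is_variety (fun A => satisfies A i).
Proof.
  split.
  - intros A B f Hf Hsurj. exact (satisfies_hom_image A B f i Hf Hsurj).
  - intros A B f Hf Hinj HB v. apply Hinj.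
    rewrite !(eval_hom A B f Hf). apply HB.
  - intros I A HA v. apply functional_extensionality_dep; intros j.
    rewrite !eval_prod. apply HA.
Qed.

(** * The two identities in chains *)

Lemma chain_satisfies_C2 (A : algebra) :
  is_comm_l_monoid A -> totally_ordered A -> satisfies A C2.
Proof.
  intros HA Htot v; simpl. set (x := v 0); set (y := v 1).
  assert (Hmono : forall a b : A, a ⊑ b -> neutral ⊓ a ⊑ neutral ⊓ b).
  { intros a b H. apply (le_meet A HA); [apply (le_meet_l A HA) |].
    apply (le_trans A HA) with a; [apply (le_meet_r A HA) | exact H]. }
  (* The join is the larger argument, so monotonicity settles both cases. *)
  destruct (Htot x y) as [H | H].
  - rewrite (proj1 (le_joinP A HA x y) H). symmetry.
    apply (le_joinP A HA), Hmono, H.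
  - rewrite (join_comm A (clm_lattice A HA) x y),
      (proj1 (le_joinP A HA y x) H),
      (join_comm A (clm_lattice A HA)). symmetry.
    apply (le_joinP A HA), Hmono, H.
Qed.

Lemma chain_satisfies_E2 (A : algebra) :
  srl_monoid A -> totally_ordered A -> satisfies A E2.
Proof.
  intros [HA [Q [_ Himp]]] Htot v; simpl.
  set (x := v 0); set (y := v 1); set (z := v 2).
  assert (Hmono : forall a b : A, a ⊑ b -> (z ⇒ a) ⊑ (z ⇒ b)).
  { intros a b H. destruct (Himp z a) as [[Ha Ha'] _].
    apply (Himp z b); split; [exact Ha |].
    apply (le_trans A HA) with a; assumption. }
  destruct (Htot x y) as [H | H].
  - rewrite (proj1 (le_joinP A HA x y) H). symmetry.
    apply (le_joinP A HA), Hmono, H.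
  - rewrite (join_comm A (clm_lattice A HA) x y),
      (proj1 (le_joinP A HA y x) H),
      (join_comm A (clm_lattice A HA)). symmetry.
    apply (le_joinP A HA), Hmono, H.
Qed.

(** * Congruences and quotient algebras *)

Record is_congruence (A : algebra) (E : A -> A -> Prop) : Prop := IsCongruence {
  congr_refl : forall x : A, E x x;
  congr_sym : forall x y : A, E x y -> E y x;
  congr_trans : forall x y z : A, E x y -> E y z -> E x z;
  congr_meet : forall x x' y y' : A, E x x' -> E y y' -> E (x ⊓ y) (x' ⊓ y');
  congr_join : forall x x' y y' : A, E x x' -> E y y' -> E (x ⊔ y) (x' ⊔ y');
  congr_mul : forall x x' y y' : A, E x x' -> E y y' -> E (x ⋅ y) (x' ⋅ y');
  congr_imp : forall x x' y y' : A, E x x' -> E y y' -> E (x ⇒ y) (x' ⇒ y')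
}.

Section Quotient.

Variables (A : algebra) (E : A -> A -> Prop).

(** Classes are predicates, so that extensionality turns equivalence of representatives into Leibniz
    equality of classes. *)
Definition quotient_carrier : Type := {C : A -> Prop | exists a : A, C = E a}.

Definition class_of (a : A) : quotient_carrier :=
  exist _ (E a) (ex_intro _ a eq_refl).

Definition class_repr (c : quotient_carrier) : A :=
  proj1_sig (constructive_indefinite_description _ (proj2_sig c)).

(* The operations act on chosen representatives, so that the algebra is defined
   for an arbitrary relation [E], congruence or not. *)
Definition quotient : algebra :=
  Algebra quotient_carrier
    (fun x y => class_of (class_repr x ⊓ class_repr y))
    (fun x y => class_of (class_repr x ⊔ class_repr y))
    (fun x y => class_of (class_repr x ⋅ class_repr y))
    (fun x y => class_of (class_repr x ⇒ class_repr y))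
    (class_of neutral).

Lemma class_of_repr (c : quotient_carrier) : class_of (class_repr c) = c.
Proof.
  unfold class_repr. destruct constructive_indefinite_description as [a Ha].
  destruct c as [C HC]; simpl in *. subst C.
  unfold class_of. f_equal. apply proof_irrelevance.
Qed.

Hypothesis HE : is_congruence A E.

Lemma class_of_eq (x y : A) : class_of x = class_of y <-> E x y.
Proof.
  destruct HE as [Hr Hs Ht _ _ _ _]. split; intros H.
  - apply (f_equal (@proj1_sig _ _)) in H; simpl in H. rewrite H. apply Hr.
  - assert (K : E x = E y).
    { apply functional_extensionality; intros z.
      apply propositional_extensionality; split; eauto. }
    (* The proof component depends on [E x], so it is generalized before [E x] is rewritten. *)
    unfold class_of. generalize (ex_intro (fun a => E x = E a) x eq_refl).
    rewrite K. intros H'. f_equal. apply proof_irrelevance.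
Qed.

Lemma class_of_hom : is_hom A quotient class_of.
Proof.
  assert (Hr : forall a, E a (class_repr (class_of a)))
    by (intros a; apply class_of_eq; rewrite class_of_repr; reflexivity).
  split; try reflexivity; intros a b; apply class_of_eq.
  - apply (congr_meet A E HE); apply Hr.
  - apply (congr_join A E HE); apply Hr.
  - apply (congr_mul A E HE); apply Hr.
  - apply (congr_imp A E HE); apply Hr.
Qed.

(** The argument passes through the identities, which a homomorphic image inherits; no subalgebra
    [Q] of the quotient has to be exhibited. *)
Lemma srl_monoid_quotient : srl_monoid A -> srl_monoid quotient.
Proof.
  intros HA. apply srl_identities_basis; intros i Hi.
  apply (satisfies_hom_image A quotient class_of i class_of_hom).
  - intros c. exists (class_repr c). apply class_of_repr.
  - apply srl_identities_basis; assumption.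
Qed.

End Quotient.

(** * Powers and comaximal pairs in the negative cone *)

Fixpoint power {A : algebra} (p : A) (n : nat) : A :=
  match n with 0 => neutral | S n => p ⋅ power p n end.

Section NegativeCone.

Variable A : algebra.
Hypothesis HA : is_comm_l_monoid A.

Lemma mul_mono_l (a b c : A) : a ⊑ b -> a ⋅ c ⊑ b ⋅ c.
Proof.
  intros H. rewrite !(mul_comm A HA _ c). apply (mul_mono A HA), H.
Qed.

Lemma mul_mono2 (a b c d : A) : a ⊑ b -> c ⊑ d -> a ⋅ c ⊑ b ⋅ d.
Proof.
  intros H K. apply (le_trans A HA) with (b ⋅ c).
  - apply mul_mono_l, H.
  - apply (mul_mono A HA), K.
Qed.

Lemma neg_mul_le (f x : A) : f ⊑ neutral -> f ⋅ x ⊑ x.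
Proof. intros H. rewrite <- (unit_mul A HA x) at 2. apply mul_mono_l, H. Qed.

Lemma neg_mul (f g : A) : f ⊑ neutral -> g ⊑ neutral -> f ⋅ g ⊑ neutral.
Proof.
  intros H K. apply (le_trans A HA) with g; [apply neg_mul_le, H | exact K].
Qed.

Lemma mul_interchange (a b c d : A) : (a ⋅ b) ⋅ (c ⋅ d) = (a ⋅ c) ⋅ (b ⋅ d).
Proof.
  rewrite <- !(mul_assoc A HA). f_equal. rewrite !(mul_assoc A HA). f_equal.
  apply (mul_comm A HA).
Qed.

Lemma power_add (p : A) (m n : nat) : power p (m + n) = power p m ⋅ power p n.
Proof.
  induction m as [| m IH]; simpl.
  - symmetry. apply (unit_mul A HA).
  - rewrite IH. apply (mul_assoc A HA).
Qed.

Lemma neg_power (p : A) (n : nat) : p ⊑ neutral -> power p n ⊑ neutral.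
Proof.
  intros H. induction n; simpl; [apply (le_refl A HA) | apply neg_mul; auto].
Qed.

(** Expand [(p ⊔ q) ⋅ (p' ⊔ q)], which equals [neutral], into [p ⋅ p'], [p ⋅ q] and
    [q ⋅ (p' ⊔ q) = q]; the middle term is below [q] because [p] is negative. *)
Lemma comaximal_mul (p p' q : A) :
  p ⊑ neutral -> p' ⊑ neutral -> q ⊑ neutral ->
  p ⊔ q = neutral -> p' ⊔ q = neutral -> (p ⋅ p') ⊔ q = neutral.
Proof.
  intros Hp Hp' Hq H H'. apply (le_antisym A HA).
  - apply (join_le A HA); [apply neg_mul; assumption | exact Hq].
  - rewrite <- (mul_unit A HA neutral). rewrite <- H at 1. rewrite <- H'.
    rewrite (mul_join_distr A HA). apply (join_le A HA).
    + rewrite (mul_comm A HA p), (mul_join_distr A HA), (mul_comm A HA p').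
      apply (join_le A HA); [apply (le_join_l A HA) |].
      apply (le_trans A HA) with q; [| apply (le_join_r A HA)].
      rewrite (mul_comm A HA). apply neg_mul_le, Hp.
    + rewrite H', (mul_unit A HA). apply (le_join_r A HA).
Qed.

Lemma comaximal_power_l (p q : A) (n : nat) :
  p ⊑ neutral -> q ⊑ neutral -> p ⊔ q = neutral -> power p n ⊔ q = neutral.
Proof.
  intros Hp Hq H. induction n as [| n IH]; simpl.
  - rewrite (join_comm A (clm_lattice A HA)). apply (le_joinP A HA), Hq.
  - apply comaximal_mul; auto using neg_power.
Qed.

Lemma comaximal_power (p q : A) (m n : nat) :
  p ⊑ neutral -> q ⊑ neutral -> p ⊔ q = neutral ->
  power p m ⊔ power q n = neutral.
Proof.
  intros Hp Hq H. rewrite (join_comm A (clm_lattice A HA)).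
  apply comaximal_power_l; auto using neg_power.
  rewrite (join_comm A (clm_lattice A HA)). apply comaximal_power_l; auto.
Qed.

End NegativeCone.

(** * Implication and prelinearity *)

Section SrlMonoid.

Variables (A : algebra) (Q : A -> Prop).
Hypothesis HA : is_comm_l_monoid A.
Hypothesis HQ : l_monoid_subalgebra A Q.
Hypothesis Himp :
  forall a b : A, is_max (fun q : A => Q q /\ a ⋅ q ⊑ b) (a ⇒ b).

Lemma imp_in (a b : A) : Q (a ⇒ b).
Proof. apply (Himp a b). Qed.

Lemma imp_eval (a b : A) : a ⋅ (a ⇒ b) ⊑ b.
Proof. apply (Himp a b). Qed.

Lemma imp_max (a b q : A) : Q q -> a ⋅ q ⊑ b -> q ⊑ (a ⇒ b).
Proof. intros H K. apply (Himp a b); auto. Qed.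

Lemma imp_antimono (a a' b : A) : a' ⊑ a -> (a ⇒ b) ⊑ (a' ⇒ b).
Proof.
  intros H. apply imp_max; [apply imp_in |].
  apply (le_trans A HA) with (a ⋅ (a ⇒ b)); [| apply imp_eval].
  apply (mul_mono_l A HA), H.
Qed.

(** With [z := x ⊔ y], E2 splits [x ⊔ y ⇒ x ⊔ y], which is above [neutral], into two implications;
    antitonicity bounds them by [y ⇒ x] and [x ⇒ y]. C2 then distributes the meet with [neutral]. *)
Lemma prelinearity (HC : satisfies A C2) (HE : satisfies A E2) (x y : A) :
  (neutral ⊓ (x ⇒ y)) ⊔ (neutral ⊓ (y ⇒ x)) = neutral.
Proof.
  pose (w := fun (a b c : A) (n : nat) =>
               match n with 0 => a | 1 => b | _ => c end).
  transitivity (neutral ⊓ ((x ⇒ y) ⊔ (y ⇒ x))).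
  { symmetry. exact (HC (w (x ⇒ y) (y ⇒ x) x)). }
  assert (H := HE (w x y (x ⊔ y))); simpl in H.
  change (neutral ⊑ (x ⇒ y) ⊔ (y ⇒ x)).
  apply (le_trans A HA) with (x ⊔ y ⇒ x ⊔ y).
  - apply imp_max; [apply (sub_unit A Q HQ) |].
    rewrite (mul_unit A HA). apply (le_refl A HA).
  - rewrite H. apply (join_le A HA).
    + apply (le_trans A HA) with (y ⇒ x); [| apply (le_join_r A HA)].
      apply imp_antimono, (le_join_r A HA).
    + apply (le_trans A HA) with (x ⇒ y); [| apply (le_join_l A HA)].
      apply imp_antimono, (le_join_l A HA).
Qed.

(* Multiplicatively closed, but possibly without the unit: this way the empty
   set qualifies, as Zorn's lemma for unions of chains requires. *)
Record neg_subsemigroup (F : A -> Prop) : Prop := NegSubsemigroup {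
  nsg_in : forall f : A, F f -> Q f;
  nsg_neg : forall f : A, F f -> f ⊑ neutral;
  nsg_mul : forall f g : A, F f -> F g -> F (f ⋅ g)
}.

Definition le_mod (F : A -> Prop) (x y : A) : Prop :=
  exists f : A, F f /\ f ⋅ x ⊑ y.

Definition eq_mod (F : A -> Prop) (x y : A) : Prop :=
  le_mod F x y /\ le_mod F y x.

(** * The congruence of a submonoid of the negative cone *)

Section Congruence.

Variable F : A -> Prop.
Hypothesis HF : neg_subsemigroup F.
Hypothesis HF1 : F neutral.

Lemma le_mod_le (x y : A) : x ⊑ y -> le_mod F x y.
Proof. intros H. exists neutral. rewrite (unit_mul A HA). auto. Qed.

Lemma le_mod_trans (x y z : A) : le_mod F x y -> le_mod F y z -> le_mod F x z.
Proof.
  intros [f [Ff H]] [g [Fg K]]. exists (g ⋅ f).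
  split; [apply (nsg_mul F HF); assumption |]. rewrite <- (mul_assoc A HA).
  apply (le_trans A HA) with (g ⋅ y); [| exact K]. apply (mul_mono A HA), H.
Qed.

(** A negative extra factor only lowers the left side, so [f ⋅ g] can serve as a common witness for
    two comparisons modulo [F]. *)
Lemma neg_mul_le_l (f g x y : A) : F f -> F g -> f ⋅ x ⊑ y -> (f ⋅ g) ⋅ x ⊑ y.
Proof.
  intros Ff Fg H. rewrite (mul_comm A HA f), <- (mul_assoc A HA).
  apply (le_trans A HA) with (f ⋅ x); [| exact H].
  apply (neg_mul_le A HA), (nsg_neg F HF), Fg.
Qed.

Lemma neg_mul_le_r (f g x y : A) : F f -> F g -> g ⋅ x ⊑ y -> (f ⋅ g) ⋅ x ⊑ y.
Proof. rewrite (mul_comm A HA f). auto using neg_mul_le_l. Qed.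

Lemma le_mod_meet (x y z : A) :
  le_mod F z x -> le_mod F z y -> le_mod F z (x ⊓ y).
Proof.
  intros [f [Ff H]] [g [Fg K]]. exists (f ⋅ g).
  split; [apply (nsg_mul F HF); assumption |].
  apply (le_meet A HA); auto using neg_mul_le_l, neg_mul_le_r.
Qed.

Lemma le_mod_join (x y z : A) :
  le_mod F x z -> le_mod F y z -> le_mod F (x ⊔ y) z.
Proof.
  intros [f [Ff H]] [g [Fg K]]. exists (f ⋅ g).
  split; [apply (nsg_mul F HF); assumption |].
  rewrite (mul_comm A HA), (mul_join_distr A HA), !(mul_comm A HA _ (f ⋅ g)).
  apply (join_le A HA); auto using neg_mul_le_l, neg_mul_le_r.
Qed.

Lemma le_mod_mul (x x' y y' : A) :
  le_mod F x x' -> le_mod F y y' -> le_mod F (x ⋅ y) (x' ⋅ y').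
Proof.
  intros [f [Ff H]] [g [Fg K]]. exists (f ⋅ g).
  split; [apply (nsg_mul F HF); assumption |].
  rewrite (mul_interchange A HA). apply (mul_mono2 A HA); assumption.
Qed.

(** Since [F] lies in [Q], the element [(f ⋅ g) ⋅ (x ⇒ y)] competes for the maximum [x' ⇒ y']:
    multiplied by [x'] it is below [g ⋅ (x ⋅ (x ⇒ y))], hence below [g ⋅ y] and [y']. *)
Lemma le_mod_imp (x x' y y' : A) :
  le_mod F x' x -> le_mod F y y' -> le_mod F (x ⇒ y) (x' ⇒ y').
Proof.
  intros [f [Ff H]] [g [Fg K]]. exists (f ⋅ g).
  split; [apply (nsg_mul F HF); assumption |].
  apply imp_max.
  - apply (sub_mul A Q HQ); [| apply imp_in].
    apply (sub_mul A Q HQ); apply (nsg_in F HF); assumption.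
  - apply (le_trans A HA) with (g ⋅ y); [| exact K].
    rewrite (mul_assoc A HA), (mul_comm A HA x'), (mul_comm A HA f g),
      <- !(mul_assoc A HA).
    apply (mul_mono A HA). rewrite (mul_assoc A HA).
    apply (le_trans A HA) with (x ⋅ (x ⇒ y)); [| apply imp_eval].
    apply (mul_mono_l A HA), H.
Qed.

Lemma eq_mod_congruence : is_congruence A (eq_mod F).
Proof.
  assert (Hl : forall x y, le_mod F (x ⊓ y) x)
    by (intros; apply le_mod_le, (le_meet_l A HA)).
  assert (Hr : forall x y, le_mod F (x ⊓ y) y)
    by (intros; apply le_mod_le, (le_meet_r A HA)).
  assert (Kl : forall x y, le_mod F x (x ⊔ y))
    by (intros; apply le_mod_le, (le_join_l A HA)).
  assert (Kr : forall x y, le_mod F y (x ⊔ y))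
    by (intros; apply le_mod_le, (le_join_r A HA)).
  split.
  - intros x. split; apply le_mod_le, (le_refl A HA).
  - intros x y []; split; assumption.
  - intros x y z [] []; split; eapply le_mod_trans; eassumption.
  - intros x x' y y' [] []; split; apply le_mod_meet;
      (* Backtracking through [+] selects the projection for which a hypothesis closes the second
         goal. *)
      (eapply le_mod_trans; [apply Hl + apply Hr | assumption]).
  - intros x x' y y' [] []; split; apply le_mod_join;
      (eapply le_mod_trans; [eassumption | apply Kl + apply Kr]).
  - intros x x' y y' [] []; split; apply le_mod_mul; assumption.
  - intros x x' y y' [] []; split; apply le_mod_imp; assumption.
Qed.

Lemma class_le (x y : A) : le_mod F x y ->
  le (A := quotient A (eq_mod F))
    (class_of A (eq_mod F) x) (class_of A (eq_mod F) y).
Proof.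
  intros H. unfold le.
  rewrite <- (hom_meet _ _ _ (class_of_hom A _ eq_mod_congruence)).
  apply (class_of_eq A _ eq_mod_congruence). split.
  - apply le_mod_le, (le_meet_l A HA).
  - apply le_mod_meet; [apply le_mod_le, (le_refl A HA) | exact H].
Qed.

End Congruence.

(** * Prime submonoids: total quotients and separation *)

Record neg_prime (F : A -> Prop) : Prop := NegPrime {
  np_nsg : neg_subsemigroup F;
  np_unit : F neutral;
  np_prime : forall p q : A, Q p -> Q q -> p ⊑ neutral -> q ⊑ neutral ->
    p ⊔ q = neutral -> F p \/ F q
}.

(** Primality applies to the pair from [prelinearity]; whichever component lies in [F] is itself the
    witness for a comparison of [x] and [y]. *)
Lemma prime_quotient_total (HC : satisfies A C2) (HE : satisfies A E2)
  (F : A -> Prop) : neg_prime F -> totally_ordered (quotient A (eq_mod F)).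
Proof.
  intros [HF HF1 Hprime] c d.
  rewrite <- (class_of_repr A _ c), <- (class_of_repr A _ d).
  set (x := class_repr A _ c); set (y := class_repr A _ d).
  assert (H : forall x y, F (neutral ⊓ (x ⇒ y)) -> le_mod F x y).
  { intros a b H. exists (neutral ⊓ (a ⇒ b)). split; [exact H |].
    rewrite (mul_comm A HA).
    apply (le_trans A HA) with (a ⋅ (a ⇒ b)); [| apply imp_eval].
    apply (mul_mono A HA), (le_meet_r A HA). }
  assert (Hq : forall x y, Q (neutral ⊓ (x ⇒ y)))
    by (intros; apply (sub_meet A Q HQ); [apply (sub_unit A Q HQ) | apply imp_in]).
  destruct (Hprime _ _ (Hq x y) (Hq y x) (le_meet_l A HA _ _)
              (le_meet_l A HA _ _) (prelinearity HC HE x y)) as [K | K].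
  - left. apply class_le; auto.
  - right. apply class_le; auto.
Qed.

(** Zorn's lemma applies because two elements of a union of a chain lie in one member, and a
    violation of avoidance involves a single [f]. *)
Lemma maximal_avoiding (a b : A) : exists F : A -> Prop,
  (neg_subsemigroup F /\ ~ le_mod F a b) /\
  forall G : A -> Prop, (forall f, F f -> G f) ->
    neg_subsemigroup G -> ~ le_mod G a b -> forall f, G f -> F f.
Proof.
  destruct (@classical_sets.Zorn_bigcup A
              (fun F => neg_subsemigroup F /\ ~ le_mod F a b))
    as [F [HF Hmax]].
  - intros C HC Htot.
    assert (HC1 : forall X, C X -> neg_subsemigroup X) by (intros; now apply HC).
    split; [split |].
    + intros f [X CX Xf]. apply (nsg_in X); auto.
    + intros f [X CX Xf]. apply (nsg_neg X); auto.
    + intros f g [X CX Xf] [Y CY Yg].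
      destruct (Htot X Y CX CY) as [S | S].
      * exists Y; [exact CY |]. apply (nsg_mul Y); auto; apply S, Xf.
      * exists X; [exact CX |]. apply (nsg_mul X); auto; apply S, Yg.
    + intros [f [[X CX Xf] H]]. apply (HC X CX). exists f; auto.
  - exists F. split; [exact HF |]. intros G HFG HG Hab f Gf.
    (* Zorn's lemma rules out proper supersets; an element of [G] outside [F] would make [G] one. *)
    apply NNPP; intros nFf. apply (Hmax G); [| split; assumption].
    split; [exact HFG |]. intros HGF. apply nFf, HGF, Gf.
Qed.

Lemma neg_prime_separates (a b : A) : ~ a ⊑ b ->
  exists F : A -> Prop, neg_prime F /\ ~ le_mod F a b.
Proof.
  intros Hab. destruct (maximal_avoiding a b) as [F [[HF Hav] Hmax]].
  (* Adjoining the unit preserves avoidance because [a ⊑ b] fails, so maximality puts [neutral] in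
     [F]. *)
  set (F1 := fun f => f = neutral \/ F f).
  assert (HF1 : neg_subsemigroup F1).
  { split.
    - intros f [-> | Ff]; [apply (sub_unit A Q HQ) | apply (nsg_in F HF), Ff].
    - intros f [-> | Ff]; [apply (le_refl A HA) | apply (nsg_neg F HF), Ff].
    - intros f g [-> | Ff] [-> | Fg].
      + left. apply (mul_unit A HA).
      + right. rewrite (unit_mul A HA). exact Fg.
      + right. rewrite (mul_unit A HA). exact Ff.
      + right. apply (nsg_mul F HF); assumption. }
  assert (Hunit : F neutral).
  { apply (Hmax F1); [intros f Ff; right; exact Ff | exact HF1 | | now left].
    intros [f [[-> | Ff] H]].
    - apply Hab. rewrite (unit_mul A HA) in H. exact H.
    - apply Hav. exists f; auto. }
  assert (Hext : forall p, Q p -> p ⊑ neutral -> ~ F p ->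
            exists f n, F f /\ (f ⋅ power p n) ⋅ a ⊑ b).
  { intros p Qp Hp nFp. apply NNPP; intros Hno. apply nFp.
    (* This is the submonoid generated by [F] and [p]; if it still avoided the pair, maximality
       would put [p] in [F]. *)
    apply (Hmax (fun g => exists f n, F f /\ g = f ⋅ power p n)).
    - intros f Ff. exists f, 0. simpl. rewrite (mul_unit A HA). auto.
    - split.
      + intros g [f [n [Ff ->]]].
        apply (sub_mul A Q HQ); [apply (nsg_in F HF), Ff |].
        induction n; simpl; [apply (sub_unit A Q HQ) |].
        apply (sub_mul A Q HQ); assumption.
      + intros g [f [n [Ff ->]]].
        apply (neg_mul A HA); [apply (nsg_neg F HF), Ff |].
        apply (neg_power A HA), Hp.
      + intros g g' [f [n [Ff ->]]] [f' [n' [Ff' ->]]].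
        exists (f ⋅ f'), (n + n'). split; [apply (nsg_mul F HF); assumption |].
        rewrite (power_add A HA). apply (mul_interchange A HA).
    - intros [g [[f [n [Ff ->]]] H]]. apply Hno. exists f, n; auto.
    - exists neutral, 1. split; [exact Hunit |]. simpl.
      rewrite (mul_unit A HA), (unit_mul A HA). reflexivity. }
  exists F. split; [split; auto | exact Hav].
  intros p q Qp Qq Hp Hq Hpq. apply NNPP; intros Hno.
  destruct (Hext p) as [f [n [Ff H]]]; auto.
  destruct (Hext q) as [g [m [Fg K]]]; auto.
  apply Hav. exists (f ⋅ g). split; [apply (nsg_mul F HF); assumption |].
  (* Replace the unit in [(f ⋅ g) ⋅ neutral] by [power p n ⊔ power q m] and distribute: one summand
     is controlled by [H], the other by [K]. *)
  rewrite <- (mul_unit A HA (f ⋅ g)),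
    <- (comaximal_power A HA p q n m Hp Hq Hpq),
    (mul_comm A HA (f ⋅ g)), !(mul_join_distr A HA).
  apply (join_le A HA).
  - apply (le_trans A HA) with ((f ⋅ power p n) ⋅ a); [| exact H].
    apply (mul_mono_l A HA). rewrite (mul_comm A HA).
    apply (mul_mono_l A HA). rewrite (mul_comm A HA).
    apply (neg_mul_le A HA), (nsg_neg F HF), Fg.
  - apply (le_trans A HA) with ((g ⋅ power q m) ⋅ a); [| exact K].
    apply (mul_mono_l A HA). rewrite (mul_comm A HA).
    apply (mul_mono_l A HA).
    apply (neg_mul_le A HA), (nsg_neg F HF), Ff.
Qed.

(** * Embedding into a product of chains *)

Lemma srl_monoid_C2_E2_SRc : satisfies A C2 -> satisfies A E2 -> SRc A.
Proof.
  intros HC HE V HV Hchain.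
  pose (B := fun F : {F : A -> Prop | neg_prime F} =>
               quotient A (eq_mod (proj1_sig F))).
  assert (Hcong : forall F : {F : A -> Prop | neg_prime F},
            is_congruence A (eq_mod (proj1_sig F))).
  { intros [F HF]. apply eq_mod_congruence; apply HF. }
  apply (variety_S V HV A (prod_algebra _ B)
           (fun a F => class_of A (eq_mod (proj1_sig F)) a)).
  - split; intros; apply functional_extensionality_dep; intros F;
      apply (class_of_hom A _ (Hcong F)).
  (* Injectivity: if [a ⊑ b] failed, some prime [F] would separate [a] from [b]; the reverse
     inequality is symmetric. *)
  - assert (Hle : forall a b : A,
      (forall F : {F : A -> Prop | neg_prime F}, eq_mod (proj1_sig F) a b) ->
      a ⊑ b).
    { intros a b H. apply NNPP; intros Hab.
      destruct (neg_prime_separates a b Hab) as [F [HF K]].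
      apply K, (H (exist _ F HF)). }
    intros a b H.
    assert (Heq : forall F : {F : A -> Prop | neg_prime F},
              eq_mod (proj1_sig F) a b).
    { intros F. apply (class_of_eq A _ (Hcong F)).
      exact (f_equal (fun g : prod_algebra _ B => g F) H). }
    apply (le_antisym A HA); apply Hle; auto.
    intros F. split; apply Heq.
  - apply (variety_P V HV). intros F. apply Hchain. split.
    + apply srl_monoid_quotient; [apply Hcong |]. split; [exact HA | eauto].
    + apply prime_quotient_total; auto. apply proj2_sig.
Qed.

End SrlMonoid.

Theorem theorem5p5 (Sigma : identity -> Prop)
  (hSigma : equational_basis Sigma srl_monoid) :
  equational_basis (fun i : identity => Sigma i \/ i = C2 \/ i = E2) SRc.
Proof.
  intros A. split.
  (* The models of [i] form a variety, so it suffices to check [i] in the generating chains. *)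
  - intros HA i Hi. apply (HA _ (satisfies_variety i)).
    intros B [HB Htot]. destruct Hi as [Hi | [-> | ->]].
    + apply hSigma; assumption.
    + apply chain_satisfies_C2; [apply HB | exact Htot].
    + apply chain_satisfies_E2; assumption.
  - intros H.
    assert (HA : srl_monoid A) by (apply hSigma; auto).
    destruct HA as [HA [Q [HQ Himp]]].
    apply (srl_monoid_C2_E2_SRc A Q HA HQ Himp); auto.
Qed.
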